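(* Let $B_2^4\subset\mathbb{R}^4$ be the Euclidean unit ball. For $K_1=K_2=B_2^4$, $$\delta_{\mathrm L}(K_1\times K_2)>\delta_{\mathrm L}(K_1)\,\delta_{\mathrm L}(K_2).$$ More precisely, $$\delta_{\mathrm L}(B_2^4\times B_2^4)\ \ge\ \frac{\pi^4}{1024}\left(1+\frac1{\sqrt5}\right)^4\ >\ \frac{\pi^4}{256}\ =\ \delta_{\mathrm L}(B_2^4)^2 .$$
   Context: For a convex body $K\subset\mathbb{R}^n$ and a full-rank lattice $\Lambda\subset\mathbb{R}^n$, the translates $K+\lambda$ ($\lambda\in\Lambda$) form a lattice packing of $K$ with center lattice $\Lambda$ if they have pairwise disjoint interiors; its density is $\operatorname{vol}(K)/\operatorname{covol}(\Lambda)$, where $\operatorname{vol}$ is Euclidean volume and $\operatorname{covol}$ is the covolume of the lattice. The maximal lattice packing density $\delta_{\mathrm L}(K)$ is the supremum of the densities of all lattice packings of $K$. The Cartesian product $B_2^4\times B_2^4$ is regarded as a convex body in $\mathbb{R}^8=\mathbb{R}^4\oplus\mathbb{R}^4$. *)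

(* Defs.v *)
From HB Require Import structures.
From mathcomp Require Import all_boot all_order all_algebra.
From mathcomp Require Import all_classical all_reals all_analysis.

Set Implicit Arguments.
Unset Strict Implicit.
Unset Printing Implicit Defensive.

Import Order.TTheory GRing.Theory Num.Theory.
Import numFieldNormedType.Exports.

Local Open Scope classical_set_scope.
Local Open Scope ring_scope.

(* Lebesgue measure on R^n is built as the iterated product of the            *)
(* one-dimensional Lebesgue measure, transported to n-tuples.                 *)
Section lebesgue_cons.
Context {R : realType} {n : nat}.
Local Notation T := (measurableTypeR R).

Let pair_cons (p : T * n.-tuple T) : n.+1.-tuple T := [tuple of p.1 :: p.2].

Let split_cons (t : n.+1.-tuple T) : T * n.-tuple T :=
  (thead t, [tuple of behead t]).

Let pair_consK : cancel pair_cons split_cons.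
Proof. by move=> [x t]; congr pair; apply: val_inj. Qed.

Let measurable_pair_cons : measurable_fun [set: _] pair_cons.
Proof.
by apply: (@measurable_cons _ _ _ _ fst _ snd);
  [exact: measurable_fst | exact: measurable_snd].
Qed.

Let measurable_split_cons : measurable_fun [set: _] split_cons.
Proof.
apply/measurable_fun_pairP; split.
  exact: (@measurable_tnth _ _ _ ord0).
exact: measurable_behead.
Qed.

Variable m : {sigma_finite_measure set n.-tuple T -> \bar R}.

Definition lebesgue_cons : set (n.+1.-tuple T) -> \bar R :=
  pushforward (@lebesgue_measure R \x m)%E
    (fun p : T * n.-tuple T => [tuple of p.1 :: p.2]).

Let lebesgue_cons0 : lebesgue_cons set0 = 0%E.
Proof. by rewrite /lebesgue_cons /pushforward preimage_set0 measure0. Qed.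

Let lebesgue_cons_ge0 A : (0 <= lebesgue_cons A)%E.
Proof. exact: measure_ge0. Qed.

Let measurable_preimage_cons A :
  measurable A -> measurable (pair_cons @^-1` A).
Proof.
by move=> mA; rewrite -[X in measurable X]setTI; exact: measurable_pair_cons.
Qed.

Let lebesgue_cons_sigma_additive : semi_sigma_additive lebesgue_cons.
Proof.
move=> F mF tF mUF; rewrite /lebesgue_cons /pushforward preimage_bigcup.
apply: (@measure_semi_sigma_additive _ _ _ (@lebesgue_measure R \x m)%E
  (fun k => pair_cons @^-1` F k)).
- by move=> k; exact: measurable_preimage_cons.
- apply/trivIsetP => /= i j _ _ ij; rewrite -preimage_setI.
  by move/trivIsetP : tF => /(_ _ _ _ _ ij) ->//; rewrite preimage_set0.
- by rewrite -preimage_bigcup; exact: measurable_preimage_cons.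
Qed.

HB.instance Definition _ := isMeasure.Build _ _ _ lebesgue_cons
  lebesgue_cons0 lebesgue_cons_ge0 lebesgue_cons_sigma_additive.

Let lebesgue_cons_sigma_finite : sigma_finite setT lebesgue_cons.
Proof.
have /sigma_finiteP[F [TF ndF Foo]] := sigma_finiteT (@lebesgue_measure R).
have /sigma_finiteP[G [TG ndG Goo]] := sigma_finiteT m.
exists (fun k => split_cons @^-1` (F k `*` G k)).
  rewrite -preimage_bigcup; apply/seteqP; split => // t _.
  have [i _ Fi] : (\bigcup_i F i) (split_cons t).1 by rewrite -TF.
  have [j _ Gj] : (\bigcup_i G i) (split_cons t).2 by rewrite -TG.
  exists (maxn i j) => //; split.
    by move: Fi; apply/subsetPset/ndF/leq_maxl.
  by move: Gj; apply/subsetPset/ndG/leq_maxr.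
move=> k; have [mF Fk] := Foo k; have [mG Gk] := Goo k; split.
  by rewrite -[_ @^-1` _]setTI; apply: measurable_split_cons => //;
    exact: measurableX.
rewrite /lebesgue_cons /pushforward -comp_preimage.
rewrite (_ : split_cons \o _ = id); last by apply/funext; exact: pair_consK.
rewrite preimage_id.
by rewrite product_measure1E// lte_mul_pinfty// ge0_fin_numE.
Qed.

HB.instance Definition _ := @Measure_isSigmaFinite.Build _ _ _ lebesgue_cons
  lebesgue_cons_sigma_finite.

End lebesgue_cons.

Fixpoint lebesgue_tuple (R : realType) (n : nat) :
    {sigma_finite_measure set n.-tuple (measurableTypeR R) -> \bar R} :=
  match n with
  | 0 => \d_[tuple]
  | n'.+1 => lebesgue_cons (lebesgue_tuple R n')
  end.

Lemma lebesgue_tuple_box (R : realType) (n : nat)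
    (A : 'I_n -> set (measurableTypeR R)) :
  (forall i, measurable (A i)) ->
  lebesgue_tuple R n [set t | forall i, A i (tnth t i)] =
  (\prod_(i < n) lebesgue_measure (A i))%E.
Proof.
elim: n A => [|n IHn] A mA /=.
  rewrite big_ord0 diracE mem_set//.
  by case.
rewrite big_ord_recl -IHn// /lebesgue_cons /pushforward.
rewrite -product_measure1E//; last first.
  rewrite (_ : [set _ | _] = \bigcap_(i in [set: 'I_n])
    ((fun t => tnth t i) @^-1` A (lift ord0 i))).
    apply: fin_bigcap_measurable => // i _.
    rewrite -[X in measurable X]setTI.
    exact: measurable_tnth.
  by apply/seteqP; split => t /= h i; [move=> _|]; exact: h.
congr (_ _); apply/seteqP; split => -[x t] /=.
  move=> h; split; first exact: (h ord0).
  by move=> i; have := h (lift ord0 i); rewrite tnthS.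
move=> [h0 h] i; case: (unliftP ord0 i) => [j ->|->//].
by rewrite tnthS; exact: h.
Qed.

Definition vol (R : realType) (n : nat) (K : set 'rV[R]_n) : \bar R :=
  lebesgue_tuple R n [set t | K (\row_i tnth t i)].

Section lattice.
Context {R : realType} {n : nat}.
Implicit Types (B : 'M[R]_n) (L K : set 'rV[R]_n).

Definition span_int B : set 'rV[R]_n :=
  [set map_mx intr z *m B | z in [set: 'rV[int]_n]].

Definition lattice_basis L B := B \in unitmx /\ L = span_int B.

Definition full_rank_lattice L := exists B, lattice_basis L B.

(* Independent of the basis by covolE; unspecified when L is not a            *)
(* full-rank lattice.                                                         *)
Definition covol L : R := get [set `|\det B| | B in lattice_basis L].

Lemma covolE L B : lattice_basis L B -> covol L = `|\det B|.
Proof.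
have base_change B1 B2 : lattice_basis L B1 -> lattice_basis L B2 ->
    exists Z : 'M[int]_n, B1 = map_mx intr Z *m B2.
  move=> [_ L1] [_ L2].
  have rowL i : exists z : 'rV[int]_n, map_mx intr z *m B2 = row i B1.
    have : L (row i B1).
      rewrite L1; exists (delta_mx 0 i) => //.
      by rewrite map_delta_mx -rowE.
    by rewrite L2 => -[z _ <-]; exists z.
  have [f fE] := choice rowL.
  exists (\matrix_i f i); apply/row_matrixP => i.
  by rewrite row_mul -map_row rowK fE.
move=> LB; rewrite /covol; case: xgetP => [_ -> [B' LB' <-]|/(_ `|\det B|) []].
  have [Z B'E] := base_change _ _ LB' LB.
  have [Y BE] := base_change _ _ LB LB'.
  have [uB _] := LB.
  have YZ1 : map_mx intr (Y *m Z) = 1%:M :> 'M[R]_n.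
    by rewrite map_mxM -[LHS](mulmxK uB) -(mulmxA _ _ B) -B'E -BE mulmxV.
  have dYZ : \det Y * \det Z = 1.
    by apply: (@intr_inj R); rewrite -det_mulmx -det_map_mx YZ1 det1.
  rewrite B'E det_mulmx det_map_mx normrM.
  by have /orP[] := intUnitRing.unitzPl dYZ => /eqP ->; rewrite ?intrN ?normrN normr1 mul1r.
by exists B.
Qed.

Definition lattice_packing K L :=
  full_rank_lattice L /\ trivIset L (fun x => ([set x + k | k in K])°).

Definition packing_density K L : \bar R := (vol K * (covol L)^-1%:E)%E.

(* Extended-real valued, so that the supremum never takes a default value.   *)
Definition max_lattice_density K : \bar R :=
  ereal_sup [set packing_density K L | L in lattice_packing K].

Definition euclidean_ball : set 'rV[R]_n :=
  [set x | Num.sqrt (\sum_i x 0 i ^+ 2) <= 1].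

End lattice.
Arguments euclidean_ball : clear implicits.

Definition cart_prod (R : realType) (m n : nat)
    (K1 : set 'rV[R]_m) (K2 : set 'rV[R]_n) : set 'rV[R]_(m + n) :=
  [set row_mx x y | x in K1 & y in K2].

(* Main.v *)
Require Import Defs.
From mathcomp Require Import all_boot all_order all_algebra.
From mathcomp Require Import all_classical all_reals all_analysis.
From mathcomp Require Import ring lra zify.

(* Upper bound: a lattice in R^4 of minimal norm at least 2 has covolume at   *)
(* least 8. In a Korkine-Zolotareff reduced basis the Gram-Schmidt norms      *)
(* squared satisfy A2 >= 3/4 A1, A3 >= 2/3 A1 and A4 >= 3/4 A3, so the Gram   *)
(* determinant A1 A2 A3 A4 is at least A1^4 / 4. The lattice D4 attains this. *)
(*                                                                            *)
(* Lower bound: embed the icosians, a rank 4 module over Z[tau] with tau the  *)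
(* golden ratio, by x |-> (2 x, 2 tau^-1 x') where x' is the Galois           *)
(* conjugate. A nonzero x has norm P + Q tau with conjugate P + Q tau', and   *)
(* no such totally positive number has P + Q tau < 1 and                      *)
(* P + Q tau' < tau^2, so |2 x| >= 2 or |2 tau^-1 x'| >= 2. The covolume is   *)
(* 400 tau^-4, smaller than 64 = covol(D4 x D4).                              *)

(** A packing of the product only requires each nonzero lattice vector to have at least one long
    component, so a rank 8 lattice that couples the two factors can beat every product of two ball
    packings. Two covolumes decide the comparison.

    For one ball, packing means minimal norm at least 2. [Hermite_constant4] then bounds the
    covolume below by 8 ([ball4_packing_covol]), and [Hurwitz_packing] attains this, so the density
    is [(pi^2 / 2) / 8 = pi^2 / 16].

    For the product, the two components of an icosian lattice vector have squared norms that are, up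
    to scaling, conjugate elements of Z[tau], and [golden_small] forbids both from being small
    unless they vanish. This gives [icosian_pair_packing], with covolume [400 tau^-4] by
    [det_icosian_pair], hence density [pi^4 tau^4 / 1600]; since [1 + 1 / sqrt 5 = 2 tau / sqrt 5],
    this is the claimed lower bound. It exceeds [pi^4 / 256] because [(1 + 1 / sqrt 5)^4 > 4]. The
    volumes come from slicing ([lebesgue_tball4], [vol_cart_prod]). *)

Set Implicit Arguments.
Unset Strict Implicit.
Unset Printing Implicit Defensive.

Import Order.TTheory GRing.Theory Num.Theory.
Import numFieldNormedType.Exports.

Local Open Scope classical_set_scope.
Local Open Scope ring_scope.

(** * The ternary inequality behind A3 >= 2/3 A1 *)

(* The inequality to refute, h4, only gets easier as a and b decrease to their *)
(* least admissible values u = sqrt (1 - t) and v = sqrt (1 - s - t g^2). It   *)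
(* then is a concave condition in v, checked at v = (5 - 3u) / 12 and v = u.   *)
Lemma ternary_bound_aux (R : rcfType) (a b g t s : R) :
  0 <= a <= 1/2 -> 0 <= b <= 1/2 -> 0 <= g <= 1/2 -> 0 <= t ->
  1 <= a ^+ 2 + t -> t <= t * g ^+ 2 + s -> 1 <= b ^+ 2 + t * g ^+ 2 + s ->
  1 <= (1 - a - b) ^+ 2 + t * (1 - g) ^+ 2 + s -> 2 / 3 <= s.
Proof.
move=> /andP[a0 a1] /andP[b0 b1] /andP[g0 g1] t0 h1 h2 h3 h4.
case: (lerP (2/3) s) => // s1; exfalso.
have g2 : g ^+ 2 <= 1/4 by nra.
have t1 : t < 8/9 by nra.
set u := Num.sqrt (1 - t).
have u2 : u ^+ 2 = 1 - t by rewrite sqr_sqrtr; lra.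
have u0 : 0 <= u by exact: sqrtr_ge0.
set v := Num.sqrt (1 - s - t * g ^+ 2).
have gg : t * g ^+ 2 <= 2/9 by nra.
have v2 : v ^+ 2 = 1 - s - t * g ^+ 2 by rewrite sqr_sqrtr; lra.
have v0 : 0 <= v by exact: sqrtr_ge0.
have ua : u <= a by rewrite -(@ler_pXn2r _ 2)// ?nnegrE// u2; lra.
have vb : v <= b by rewrite -(@ler_pXn2r _ 2)// ?nnegrE// v2; lra.
have vu : v <= u by rewrite -(@ler_pXn2r _ 2)// ?nnegrE// u2 v2; lra.
have h5 : (1 - a - b) ^+ 2 <= (1 - u - v) ^+ 2.
  by rewrite ler_pXn2r// ?nnegrE; lra.
have tg : t * g ^+ 2 = 1 - s - v ^+ 2 by rewrite v2; ring.
have tE : t = 1 - u ^+ 2 by rewrite u2; ring.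
have u3 : 1/3 < u by rewrite -(@ltr_pXn2r _ 2)// ?nnegrE ?u2; lra.
(* A linear lower bound for [sqrt (1/12 + u^2 / 4)] on [u >= 1/3], exact at [u = 1/3]. At
   [u = v = 1/3] and [s = 2/3] the next inequality becomes an equality. *)
have v3 : (5 - 3 * u) / 12 <= v.
  have : 1/12 + u ^+ 2 / 4 <= v ^+ 2 by nra.
  by rewrite -(@ler_pXn2r _ 2)// ?nnegrE; nra.
have key1 : (1 - u) * (1 - v) ^+ 2 < (1 + u) * (1 - s - v ^+ 2).
  have : 0 <= (u - v) * (v - (5 - 3 * u) / 12) by apply: mulr_ge0; lra.
  have : 0 <= (u - 1/3) * (1/2 - u) by apply: mulr_ge0; lra.
  nra.
have key2 : ((1 - u) * (1 - v)) ^+ 2 < (t * g) ^+ 2.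
  rewrite !exprMn.
  have -> : t ^+ 2 * g ^+ 2 = (1 - u) * ((1 + u) * (1 - s - v ^+ 2)).
    have -> : t ^+ 2 * g ^+ 2 = t * (t * g ^+ 2) by ring.
    by rewrite tg {1}tE; ring.
  rewrite expr2 -mulrA ltr_pM2l//; lra.
(* Substituting [t = 1 - u^2] and [t g^2 + s = 1 - v^2], h4 together with h5 says
   [t g <= (1 - u) (1 - v)], which is refuted here. *)
have key3 : (1 - u) * (1 - v) < t * g.
  by rewrite -(@ltr_pXn2r _ 2)// ?nnegrE; apply: mulr_ge0; lra.
nra.
Qed.

Lemma shift_int_half (R : archiRealFieldType) (x : R) :
  exists k : int, `|x + k%:~R| <= 1/2.
Proof.
exists (- Num.floor (x + 1/2)); rewrite rmorphN /= ler_norml.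
have := floor_itv (x + 1/2).
rewrite intrD => /andP[]; lra.
Qed.

(** Integer changes of basis bring [a], [b], [g] into [-1/2, 1/2], and sign changes make them
    nonnegative. The hypotheses of [ternary_bound_aux] are then the values of the two forms at a few
    short vectors. *)
Lemma ternary_bound (R : realType) (a b g t s : R) : 0 <= t ->
  (forall x y z : int, ~~ [&& x == 0, y == 0 & z == 0] ->
    1 <= (x%:~R + a * y%:~R + b * z%:~R) ^+ 2 +
         t * (y%:~R + g * z%:~R) ^+ 2 + s * z%:~R ^+ 2) ->
  (forall y z : int, ~~ ((y == 0) && (z == 0)) ->
    t <= t * (y%:~R + g * z%:~R) ^+ 2 + s * z%:~R ^+ 2) ->
  2 / 3 <= s.
Proof.
move=> t0 h3 h2.
have [k hk] := shift_int_half g; have [m hm] := shift_int_half a.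
have [l hl] := shift_int_half (b + a * k%:~R).
set g' := g + _ in hk; set a' := a + _ in hm; set b' : R := _ + l%:~R in hl.
have sgn : exists2 e : int, e%:~R * g' = `|g'| & e%:~R ^+ 2 = 1 :> R.
  case: (ger0P g') => h; [exists 1|exists (-1)]; rewrite ?rmorphN1 ?rmorph1.
  - by rewrite mul1r.
  - by rewrite expr1n.
  - by rewrite mulN1r.
  - by rewrite sqrrN expr1n.
have [e eg e2] := sgn.
(* This is the value at the reduced third vector minus [e] times the second: its middle coordinate
   [g' - e] has absolute value [1 - |g'|], and [x] remains free to adjust the first coordinate. *)
have h4 (x : int) :
    1 <= (x%:~R + b' - e%:~R * a') ^+ 2 + t * (1 - `|g'|) ^+ 2 + s.
  have := h3 (x + l + - e * m) (k - e) 1; rewrite !andbF => /(_ isT).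
  rewrite !rmorphD !rmorphM !rmorphN rmorph1 /=.
  have -> : (1 - `|g'|) ^+ 2 = (g' - e%:~R) ^+ 2.
    have : e%:~R ^+ 2 * (1 - e%:~R * g') ^+ 2 =
           (e%:~R - e%:~R ^+ 2 * g') ^+ 2 by ring.
    by rewrite -eg e2 !mul1r -[RHS]sqrrN opprB.
  suff -> : (x%:~R + l%:~R + - e%:~R * m%:~R + a * (k%:~R - e%:~R) + b * 1) ^+ 2 +
    t * (k%:~R - e%:~R + g * 1) ^+ 2 + s * 1 ^+ 2 =
    (x%:~R + b' - e%:~R * a') ^+ 2 + t * (g' - e%:~R) ^+ 2 + s by [].
  rewrite /a' /b' /g'; ring.
apply: (@ternary_bound_aux _ `|a'| `|b'| `|g'| t s); rewrite ?normr_ge0 //.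
- have := h3 m 1 0; rewrite andbF => /(_ isT).
  rewrite real_normK ?num_real// /a' !(rmorph1, rmorph0) [a + _]addrC; lra.
- have := h2 k 1; rewrite andbF => /(_ isT).
  rewrite real_normK ?num_real// /g' !rmorph1 [g + _]addrC; lra.
- have := h3 l k 1; rewrite !andbF => /(_ isT).
  rewrite !real_normK ?num_real//.
  have -> : l%:~R + a * k%:~R + b * 1%:~R = b' by rewrite /b' rmorph1; ring.
  have -> : k%:~R + g * 1%:~R = g' by rewrite /g' rmorph1; ring.
  rewrite !rmorph1; lra.
- suff: exists x : int,
      (x%:~R + b' - e%:~R * a') ^+ 2 <= (1 - `|a'| - `|b'|) ^+ 2.
    by move=> [x]; have := h4 x; lra.
  have e3 : `|e%:~R * a'| = `|a'|.
    by apply: (@pexpIrn _ 2); rewrite ?nnegrE//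
      !real_normK ?num_real// exprMn e2 mul1r.
  rewrite -e3; move: e3; set c := e%:~R * a' => e3.
  have hc : `|c| <= 1/2 by rewrite e3.
  suff: exists x : int, `|x%:~R + b' - c| <= 1 - `|c| - `|b'|.
    move=> [x hx]; exists x; rewrite -[leLHS]real_normK ?num_real//.
    by rewrite ler_pXn2r// nnegrE ?normr_ge0//; lra.
  move: hc hl; clear.
  case: (ger0P c) => c0; case: (ger0P b') => b0 h1 h2;
   [exists 0|exists 1|exists (-1)|exists 0];
   rewrite ?rmorphN1 ?rmorph1 ?rmorph0 ler_norml; lra.
Qed.

(** * Positive definite forms and completing the square *)

Definition qf (R : comPzRingType) n (G : 'M[R]_n) (x : 'rV_n) : R :=
  (x *m G *m x^T) 0 0.

Definition posdef (R : numDomainType) n (G : 'M[R]_n) :=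
  G^T = G /\ forall x, x != 0 -> 0 < qf G x.

Section posdef.
Variable R : realFieldType.

Lemma qf_mulmx m n (G : 'M[R]_n) (U : 'M[R]_(m, n)) x :
  qf G (x *m U) = qf (U *m G *m U^T) x.
Proof. by rewrite /qf trmx_mul !mulmxA. Qed.

Lemma qfZ n (G : 'M[R]_n) c x : qf G (c *: x) = c ^+ 2 * qf G x.
Proof. by rewrite /qf linearZ/= -!scalemxAl -scalemxAr !mxE; ring. Qed.

Lemma qf0 n (G : 'M[R]_n) : qf G 0 = 0.
Proof. by rewrite /qf !mul0mx mxE. Qed.

Lemma posdef_ge0 n (G : 'M[R]_n) x : posdef G -> 0 <= qf G x.
Proof.
move=> [_ G0]; have [->|x0] := eqVneq x 0; first by rewrite qf0.
exact/ltW/G0.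
Qed.

Lemma posdef_congr n (G U : 'M[R]_n) :
  U \in unitmx -> posdef G -> posdef (U *m G *m U^T).
Proof.
move=> uU [GT G0]; split; first by rewrite !trmx_mul GT trmxK mulmxA.
move=> x x0; rewrite -qf_mulmx G0//; apply: contra_neq x0 => xU.
by rewrite -[x](mulmxK uU) xU mul0mx.
Qed.

Lemma qf_diag n (A : R) (S : 'M[R]_n) (x : 'rV_1) (y : 'rV_n) :
  qf (block_mx A%:M 0 0 S) (row_mx x y) = A * x 0 0 ^+ 2 + qf S y.
Proof.
rewrite /qf mul_row_block tr_row_mx mul_row_col !mulmx0 add0r addr0.
by rewrite mul_mx_scalar -scalemxAl !mxE big_ord1 !mxE expr2.
Qed.

(** Completing the square in the first variable: [G = E diag(A, S) E^T] with [E] unipotent, so [S]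
    is the Schur complement. On lattices, [S] is the Gram matrix of the projection orthogonal to the
    first basis vector. *)
Lemma posdef_schur n (G : 'M[R]_(1 + n)) : posdef G ->
  exists (A : R) (a : 'cV[R]_n) (S : 'M[R]_n),
  [/\ 0 < A, posdef S, \det G = A * \det S &
      forall (x : 'rV_1) (y : 'rV_n),
        qf G (row_mx x y) = A * (x 0 0 + (y *m a) 0 0) ^+ 2 + qf S y].
Proof.
move=> [GT G0]; pose A := G 0 0.
have A0 : 0 < A.
  have := G0 (delta_mx 0 0); rewrite /qf trmx_delta -rowE -colE !mxE.
  apply; apply/eqP => /matrixP/(_ 0 0)/eqP.
  by rewrite !mxE !eqxx oner_eq0.
pose a := A^-1 *: dlsubmx G.
pose S := drsubmx G - A *: (a *m a^T).
pose E := block_mx 1%:M 0 a 1%:M : 'M[R]_(1 + n).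
have urE : ursubmx G = (dlsubmx G)^T by rewrite trmx_dlsub GT.
have GE : G = E *m block_mx A%:M 0 0 S *m E^T.
  rewrite /E tr_block_mx !mulmx_block !trmx1 !trmx0.
  rewrite !(mul1mx, mul0mx, mulmx0, mulmx1, addr0, add0r).
  rewrite -[LHS]submxK; congr block_mx.
  - by rewrite [LHS]mx11_scalar /A !mxE; congr (G _ _)%:M; apply/val_inj.
  - by rewrite mul_scalar_mx linearZ/= scalerA divff ?gt_eqF// scale1r urE.
  - by rewrite mul_mx_scalar scalerA divff ?gt_eqF// scale1r.
  - by rewrite mul_mx_scalar -scalemxAl addrC /S subrK.
have rowE (x : 'rV_1) (y : 'rV_n) : row_mx x y *m E = row_mx (x + y *m a) y.
  by rewrite mul_row_block !mulmx1 mulmx0 add0r.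
have qE (x : 'rV_1) (y : 'rV_n) :
    qf G (row_mx x y) = A * (x 0 0 + (y *m a) 0 0) ^+ 2 + qf S y.
  by rewrite [X in qf X]GE -qf_mulmx rowE qf_diag mxE.
exists A, a, S; split=> //.
- split.
    rewrite /S linearB/= trmx_drsub GT linearZ/= trmx_mul trmxK//.
  move=> y y0; have := qE (- (y *m a)) y.
  rewrite mxE addNr expr0n mulr0 add0r => <-; apply: G0.
  by apply: contra_neq y0; rewrite -row_mx0 => /eq_row_mx[].
- by rewrite [in LHS]GE !det_mulmx det_tr !det_lblock !det1 det_scalar1; ring.
Qed.

(** Each completed square bounds one more coordinate. The purpose is that a sublevel set contains
    finitely many integer points. *)
Lemma posdef_coercive n (G : 'M[R]_n) (r : R) : posdef G ->
  exists N : R, forall x, qf G x <= r -> forall i, `|x 0 i| <= N.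
Proof.
elim: n G r => [|n IH] G r pG; first by exists 0 => x _ [].
have [A [a [S [A0 pS _ qE]]]] := @posdef_schur n G pG.
have [N HN] := IH S r pS.
pose M := r / A + 1 + \sum_i N * `|a i 0|.
exists (`|N| + `|M|) => x.
rewrite -[in X in X -> _](@hsubmxK _ 1 1 n x) qE => qx.
set u := lsubmx (x : 'rV_(1 + n)) in qx *.
set v := rsubmx (x : 'rV_(1 + n)) in qx *.
have Hv i : `|v 0 i| <= N.
  apply: HN; apply: le_trans qx.
  by rewrite lerDr mulr_ge0// ?sqr_ge0// ltW.
have Hva : `|(v *m a) 0 0| <= \sum_i N * `|a i 0|.
  rewrite mxE; apply: le_trans (ler_norm_sum _ _ _) _.
  by apply: ler_sum => i _; rewrite normrM ler_wpM2r.
have Hu : `|u 0 0 + (v *m a) 0 0| <= r / A + 1.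
  set w := u 0 0 + _.
  have : A * w ^+ 2 <= r.
    by apply: le_trans qx; rewrite lerDl; exact: posdef_ge0.
  rewrite mulrC -ler_pdivlMr// => w2.
  have : `|w| ^+ 2 <= r / A by rewrite real_normK ?num_real.
  by have := normr_ge0 w; nra.
move=> i; rewrite -[x](@hsubmxK _ 1 1 n) mxE; case: splitP => j _.
  rewrite (ord1 j); apply: le_trans (_ : M <= _); last first.
    by rewrite -[leLHS]add0r lerD// ler_norm.
  rewrite -[u 0 0](addrK ((v *m a) 0 0)); apply: le_trans (ler_normB _ _) _.
  exact: lerD.
by apply: le_trans (Hv j) _; rewrite -[leLHS]addr0 lerD ?ler_norm.
Qed.

End posdef.

(** * Attained minima and Korkine-Zolotareff reduction *)

Section lattice_minimum.
Variable R : realType.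

Lemma posdef_argmin n (G : 'M[R]_n.+1) : posdef G ->
  exists2 z : 'rV[int]_n.+1, z != 0 &
    forall w : 'rV[int]_n.+1, w != 0 ->
      qf G (map_mx intr z) <= qf G (map_mx intr w).
Proof.
move=> pG; pose e : 'rV[int]_n.+1 := delta_mx 0 0.
have e0 : e != 0 by apply/eqP => /rowP/(_ 0); rewrite !mxE.
have [N HN] := posdef_coercive (qf G (map_mx intr e)) pG.
pose K := Num.bound `|N|.
have KN : N <= K%:R.
  by apply: le_trans (ler_norm _) _; apply/ltW/archi_boundP.
(* The finite box [-K, K]^n, encoded by ordinals shifted by [K], contains every integer point that
   does at least as well as [e]. *)
pose f (t : 'rV['I_(K + K).+1]_n.+1) : 'rV[int]_n.+1 :=
  \row_i ((t 0 i)%:Z - K%:Z).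
have fP z : qf G (map_mx intr z) <= qf G (map_mx intr e) -> exists t, f t = z.
  move=> /HN Hz; exists (\row_i inord (absz (z 0 i + K%:Z))).
  apply/rowP => i; rewrite !mxE.
  have : `|z 0 i| <= K%:Z.
    rewrite -(ler_int R) intr_norm.
    by apply: le_trans KN; have := Hz i; rewrite mxE.
  rewrite ler_norml => /andP[h1 h2].
  have h0 : 0 <= z 0 i + K%:Z by lia.
  by rewrite inordK; lia.
have [te teE] := fP e (lexx _).
have te0 : f te != 0 by rewrite teE.
case: (@arg_minP _ _ _ te (fun t => f t != 0)
  (fun t => qf G (map_mx intr (f t))) te0).
move=> t t0 tmin; exists (f t) => // w w0.
case: (leP (qf G (map_mx intr w)) (qf G (map_mx intr e))) => [/fP[s sE]|/ltW].
  by rewrite -sE; apply: tmin; rewrite sE.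
by apply: le_trans; rewrite -teE; exact: tmin.
Qed.

(** The Smith normal form of a minimal vector [z] writes it as an integer multiple [c] of the first
    row of a unimodular matrix. Since [c^2 >= 1], that row is minimal too, so a minimum is attained
    at a vector that extends to a basis. *)
Lemma posdef_unimodular_min n (G : 'M[R]_n.+1) : posdef G ->
  exists2 U : 'M[int]_n.+1, U \in unitmx &
    forall w : 'rV[int]_n.+1, w != 0 ->
      qf G (map_mx intr (row 0 U)) <= qf G (map_mx intr w).
Proof.
move=> pG; have [z z0 zmin] := posdef_argmin pG.
have [L _ [U uU [d _ zE]]] := int_Smith_normal_form z.
exists U => // w /zmin; apply: le_trans.
pose c := L 0 0 * d`_0.
have {}zE : z = c *: row 0 U.
  rewrite zE (_ : L *m _ = c *: delta_mx 0 0) -?scalemxAl -?rowE//.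
  apply/rowP => j; rewrite !mxE big_ord1 !mxE /c eqxx/=.
  by case: j => -[|j] Hj /=; rewrite ?mulr1 ?mulr0 ?mulr0n ?mulr0.
have c0 : c != 0 by apply: contra_neq z0 => c0; rewrite zE c0 scale0r.
rewrite zE map_mxZ qfZ ler_peMl ?posdef_ge0//.
by rewrite -rmorphXn/= -[1](rmorph1 intr) ler_int; nia.
Qed.

(* One step of Korkine-Zolotareff reduction. *)
Lemma posdef_split n (G : 'M[R]_(1 + n)) : posdef G ->
  exists (A : R) (a : 'cV[R]_n) (S : 'M[R]_n) (U : 'M[int]_(1 + n)),
  [/\ 0 < A, posdef S & U \in unitmx] /\
  [/\ \det G = A * \det S,
      forall w : 'rV[int]_(1 + n), w != 0 -> A <= qf G (map_mx intr w) &
      forall (x : int) (y : 'rV[int]_n),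
        qf G (map_mx intr (row_mx x%:M y *m U)) =
        A * (x%:~R + (map_mx intr y *m a) 0 0) ^+ 2 + qf S (map_mx intr y)].
Proof.
move=> pG; have [U uU Umin] := posdef_unimodular_min pG.
pose V : 'M[R]_(1 + n) := map_mx intr U.
have uV : V \in unitmx.
  by rewrite unitmxE det_map_mx rmorph_unit -?unitmxE.
have dV : \det V ^+ 2 = 1.
  rewrite det_map_mx -rmorphXn/=.
  have : \det U \is a GRing.unit by rewrite -unitmxE.
  by rewrite qualifE /= => /orP[] /eqP ->; rewrite ?sqrrN expr1n.
have [A [a [S [A0 pS dG qE]]]] := posdef_schur (posdef_congr uV pG).
exists A, a, S, U; split=> //.
have qE' (x : int) (y : 'rV[int]_n) :
    qf G (map_mx intr (row_mx x%:M y *m U)) =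
    A * (x%:~R + (map_mx intr y *m a) 0 0) ^+ 2 + qf S (map_mx intr y).
  by rewrite map_mxM qf_mulmx map_row_mx qE !mxE eqxx.
split=> //.
  by rewrite -dG !det_mulmx det_tr mulrAC -expr2 dV mul1r.
move=> w /Umin; apply: le_trans.
have -> : row 0 U = row_mx 1%:M (0 : 'rV_n) *m U.
  rewrite rowE; congr (_ *m _); apply/rowP => i; rewrite !mxE.
  case: splitP => j ij; rewrite !mxE ?(ord1 j) ?eqxx.
    by rewrite (_ : i = 0)//; apply/val_inj; rewrite /= ij (ord1 j).
  by case: eqP => // i0; move: ij; rewrite i0.
by rewrite qE' map_mx0 qf0 mul0mx mxE !addr0 expr1n mulr1.
Qed.

End lattice_minimum.

(** * The sharp Hermite bound in dimension four *)

Section Hermite_constant.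
Variable R : realType.

Lemma mul_unimodular_neq0 n (U : 'M[int]_n) (z : 'rV_n) :
  U \in unitmx -> z != 0 -> z *m U != 0.
Proof.
by move=> uU; apply: contra_neq => zU; rewrite -[z](mulmxK uU) zU mul0mx.
Qed.

Lemma row_mx_eq0 m n (x : 'rV[int]_m) (y : 'rV[int]_n) :
  (row_mx x y == 0) = (x == 0) && (y == 0).
Proof.
apply/eqP/andP; first by rewrite -row_mx0 => /eq_row_mx[-> ->].
by move=> [/eqP-> /eqP->]; rewrite row_mx0.
Qed.

Lemma scalar11_eq0 (x : int) : (x%:M == 0 :> 'M[int]_1) = (x == 0).
Proof.
apply/eqP/eqP => [/matrixP/(_ 0 0)|->]; last exact: raddf0.
by rewrite !mxE eqxx.
Qed.

(** A vector of the projected lattice lifts with first coordinate at most 1/2 in absolute value. The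
    lift has value at least [A], of which the first coordinate contributes at most [A / 4]. *)
Lemma posdef_split_ge34 n (G : 'M[R]_(1 + n)) A (a : 'cV[R]_n) (S : 'M[R]_n)
    (U : 'M[int]_(1 + n)) :
  0 < A -> U \in unitmx ->
  (forall w : 'rV[int]_(1 + n), w != 0 -> A <= qf G (map_mx intr w)) ->
  (forall (x : int) (y : 'rV[int]_n),
     qf G (map_mx intr (row_mx x%:M y *m U)) =
     A * (x%:~R + (map_mx intr y *m a) 0 0) ^+ 2 + qf S (map_mx intr y)) ->
  forall y : 'rV[int]_n, y != 0 -> 3 / 4 * A <= qf S (map_mx intr y).
Proof.
move=> A0 uU GA qE y y0; set l := (map_mx intr y *m a) 0 0.
have [k hk] := shift_int_half l.
have : A <= A * (k%:~R + l) ^+ 2 + qf S (map_mx intr y).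
  by rewrite -qE GA// mul_unimodular_neq0// row_mx_eq0 (negPf y0) andbF.
have : `|l + k%:~R| ^+ 2 <= 1 / 4 by have := normr_ge0 (l + k%:~R); nra.
rewrite real_normK ?num_real// addrC; nra.
Qed.

(** Lifting [w] through both reduction steps gives a rank 3 sublattice on which [G / A1] has the
    shape treated by [ternary_bound], with [t = A2 / A1] and [s = qf S2 w / A1]. *)
Lemma posdef_split_ge23 n (G : 'M[R]_(1 + (1 + n))) A1 (a1 : 'cV[R]_(1 + n))
    (S1 : 'M[R]_(1 + n)) (U1 : 'M[int]_(1 + (1 + n))) A2 (a2 : 'cV[R]_n)
    (S2 : 'M[R]_n) (U2 : 'M[int]_(1 + n)) :
  0 < A1 -> U1 \in unitmx ->
  (forall w : 'rV[int]_(1 + (1 + n)), w != 0 -> A1 <= qf G (map_mx intr w)) ->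
  (forall (x : int) (y : 'rV[int]_(1 + n)),
     qf G (map_mx intr (row_mx x%:M y *m U1)) =
     A1 * (x%:~R + (map_mx intr y *m a1) 0 0) ^+ 2 + qf S1 (map_mx intr y)) ->
  0 < A2 -> U2 \in unitmx ->
  (forall w : 'rV[int]_(1 + n), w != 0 -> A2 <= qf S1 (map_mx intr w)) ->
  (forall (x : int) (y : 'rV[int]_n),
     qf S1 (map_mx intr (row_mx x%:M y *m U2)) =
     A2 * (x%:~R + (map_mx intr y *m a2) 0 0) ^+ 2 + qf S2 (map_mx intr y)) ->
  forall w : 'rV[int]_n, w != 0 -> 2 / 3 * A1 <= qf S2 (map_mx intr w).
Proof.
move=> A10 uU1 GA1 qE1 A20 uU2 GA2 qE2 w w0.
pose g := (map_mx intr w *m a2) 0 0.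
pose l (v : 'rV[int]_(1 + n)) := (map_mx intr v *m a1) 0 0.
pose v (y z : int) := row_mx y%:M (z *: w) *m U2.
have vE y z : v y z = y *: v 1 0 + z *: v 0 1.
  rewrite /v !scalemxAl -mulmxDl; congr (_ *m _).
  rewrite !scale_row_mx add_row_mx !scale_scalar_mx.
  by rewrite mulr1 mulr0 scale0r scaler0 scale1r add0r raddf0 addr0.
have lE y z : l (v y z) = l (v 1 0) * y%:~R + l (v 0 1) * z%:~R.
  by rewrite {1}/l vE map_mxD !map_mxZ mulmxDl -!scalemxAl !mxE /l !mxE; ring.
have v0 y z : ~~ ((y == 0) && (z == 0)) -> v y z != 0.
  move=> yz; apply: mul_unimodular_neq0 => //.
  by rewrite row_mx_eq0 scalar11_eq0 scalemx_eq0 (negPf w0) orbF.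
have qv y z : qf S1 (map_mx intr (v y z)) =
    A2 * (y%:~R + g * z%:~R) ^+ 2 + qf S2 (map_mx intr w) * z%:~R ^+ 2.
  by rewrite qE2 map_mxZ qfZ -scalemxAl !mxE /g !mxE; ring.
rewrite -ler_pdivlMr//.
apply: (@ternary_bound _ (l (v 1 0)) (l (v 0 1)) g (A2 / A1)).
- by rewrite divr_ge0// ltW.
- move=> x y z xyz; rewrite -(ler_pM2l A10) mulr1.
  have : row_mx x%:M (v y z) *m U1 != 0.
    apply: mul_unimodular_neq0 => //; rewrite row_mx_eq0 scalar11_eq0.
    by move: xyz; case: (x == 0) => //= /v0.
  move=> /GA1; rewrite qE1 -/(l _) lE qv => /le_trans; apply.
  by rewrite le_eqVlt; apply/orP; left; apply/eqP; field; rewrite gt_eqF.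
- move=> y z /v0/GA2; rewrite qv => h.
  rewrite -(ler_pM2l A10) [leLHS]mulrC divfK ?gt_eqF//; apply: le_trans h _.
  by rewrite le_eqVlt; apply/orP; left; apply/eqP; field; rewrite gt_eqF.
Qed.

Lemma qf_mx11 (S : 'M[R]_1) : qf S (map_mx intr (1%:M : 'M[int]_1)) = \det S.
Proof. by rewrite map_mx1 /qf trmx1 mul1mx mulmx1 det_mx11. Qed.

Lemma Hermite_constant4 (G : 'M[R]_4) (m : R) : posdef G -> 0 <= m ->
  (forall w : 'rV[int]_4, w != 0 -> m <= qf G (map_mx intr w)) ->
  m ^+ 4 <= 4 * \det G.
Proof.
move=> pG m0 Gm.
have [A1 [a1 [S1 [U1 [[A10 pS1 uU1] [dG GA1 qE1]]]]]] :=
  @posdef_split R 3 G pG.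
have [A2 [a2 [S2 [U2 [[A20 pS2 uU2] [dS1 GA2 qE2]]]]]] :=
  @posdef_split R 2 S1 pS1.
have [A3 [a3 [S3 [U3 [[A30 pS3 uU3] [dS2 GA3 qE3]]]]]] :=
  @posdef_split R 1 S2 pS2.
have e0 n : row_mx 1%:M (0 : 'rV_n) != 0 :> 'rV[int]_(1 + n).
  by rewrite row_mx_eq0 scalar11_eq0.
have qA n (G' : 'M[R]_(1 + n)) A (a : 'cV[R]_n) (S : 'M[R]_n) (U : 'M[int]_(1 + n)) :
    (forall (x : int) (y : 'rV[int]_n),
     qf G' (map_mx intr (row_mx x%:M y *m U)) =
     A * (x%:~R + (map_mx intr y *m a) 0 0) ^+ 2 + qf S (map_mx intr y)) ->
    qf G' (map_mx intr (row_mx 1%:M (0 : 'rV_n) *m U)) = A.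
  by move=> ->; rewrite map_mx0 qf0 mul0mx mxE !addr0 expr1n mulr1.
have mA1 : m <= A1.
  by rewrite -(qA _ _ _ _ _ _ qE1) Gm// (@mul_unimodular_neq0 4).
have A12 : 3 / 4 * A1 <= A2.
  rewrite -(qA _ _ _ _ _ _ qE2).
  by apply: (posdef_split_ge34 A10 uU1 GA1 qE1); rewrite mul_unimodular_neq0.
have A13 : 2 / 3 * A1 <= A3.
  rewrite -(qA _ _ _ _ _ _ qE3).
  apply: (posdef_split_ge23 A10 uU1 GA1 qE1 A20 uU2 GA2 qE2).
  by rewrite mul_unimodular_neq0.
(* The 1 by 1 form [S3] carries the last Gram-Schmidt norm A4, so the product of the four is at
   least [A1^4 * (3/4) * (2/3) * (1/2)]. *)
have A34 : 3 / 4 * A3 <= \det S3.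
  rewrite -qf_mx11; apply: (posdef_split_ge34 A30 uU3 GA3 qE3).
  by rewrite scalar11_eq0.
rewrite dG dS1 dS2.
have h1 : 3 / 4 * A1 ^+ 2 <= A1 * A2 by nra.
have h2 : 1 / 3 * A1 ^+ 2 <= A3 * \det S3 by nra.
have h3 : 1 / 4 * (A1 ^+ 2 * A1 ^+ 2) <= (A1 * A2) * (A3 * \det S3).
  have := sqr_ge0 A1; set B := A1 ^+ 2 in h1 h2 *; nra.
have : m ^+ 4 <= A1 ^+ 4 by rewrite lerXn2r// nnegrE ltW.
rewrite (_ : A1 ^+ 4 = A1 ^+ 2 * A1 ^+ 2); last by ring.
lra.
Qed.

End Hermite_constant.

(** * Packings and minimal norms *)

Section packings.
Variable R : realType.

Definition sqn n (x : 'rV[R]_n) : R := \sum_i x 0 i ^+ 2.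

Lemma sqnE n (x : 'rV[R]_n) : sqn x = (x *m x^T) 0 0.
Proof. by rewrite mxE; apply: eq_bigr => i _; rewrite mxE. Qed.

Lemma sqn_ge0 n (x : 'rV[R]_n) : 0 <= sqn x.
Proof. by apply: sumr_ge0 => i _; exact: sqr_ge0. Qed.

Lemma sqn_eq0 n (x : 'rV[R]_n) : (sqn x == 0) = (x == 0).
Proof.
apply/eqP/eqP => [|->]; last by apply: big1 => i _; rewrite mxE expr0n.
move=> /eqP; rewrite psumr_eq0 => [/allP x0|i _]; last exact: sqr_ge0.
apply/rowP => i; rewrite mxE.
by have := x0 i (mem_index_enum _); rewrite sqrf_eq0 => /eqP.
Qed.

Lemma sqnZ n c (x : 'rV[R]_n) : sqn (c *: x) = c ^+ 2 * sqn x.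
Proof.
by rewrite /sqn mulr_sumr; apply: eq_bigr => i _; rewrite mxE exprMn.
Qed.

Lemma sqnB_le n (x y : 'rV[R]_n) : sqn (x - y) <= 2 * (sqn x + sqn y).
Proof.
rewrite /sqn -big_split mulr_sumr; apply: ler_sum => i _; rewrite !mxE/=.
by have := sqr_ge0 (x 0 i + y 0 i); nra.
Qed.

Lemma sqn_mulmx n (B : 'M[R]_n) (x : 'rV_n) : sqn (x *m B) = qf (B *m B^T) x.
Proof. by rewrite sqnE /qf trmx_mul !mulmxA. Qed.

Lemma map_intr_eq0 n (z : 'rV[int]_n) : map_mx intr z = 0 :> 'rV[R]_n -> z = 0.
Proof.
move=> /rowP z0; apply/rowP => i; apply: (@intr_inj R).
by have := z0 i; rewrite !mxE.
Qed.

Lemma posdef_gram n (B : 'M[R]_n) : B \in unitmx -> posdef (B *m B^T).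
Proof.
move=> uB; split=> [|x x0]; first by rewrite trmx_mul trmxK.
rewrite -sqn_mulmx lt0r sqn_ge0 andbT sqn_eq0.
by apply: contra_neq x0 => xB; rewrite -[x](mulmxK uB) xB mul0mx.
Qed.

Lemma euclidean_ballE n : euclidean_ball R n = [set x | sqn x <= 1].
Proof.
have le1 (s : R) : (Num.sqrt s <= 1) = (s <= 1).
  by rewrite -[X in _ <= X]sqrtr1 ler_sqrt.
by apply/seteqP; split=> x; rewrite /euclidean_ball/= le1.
Qed.

Lemma ball_sub_sqn n (k1 k2 d : 'rV[R]_n) t :
  euclidean_ball R n k1 -> euclidean_ball R n k2 -> 1 < t ->
  k1 - k2 = t *: d -> sqn d < 4.
Proof.
rewrite euclidean_ballE /= => h1 h2 t1 E.
have := sqnB_le k1 k2; rewrite E sqnZ; have := sqn_ge0 d.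
have : 1 < t ^+ 2 by rewrite exprn_egt1.
nra.
Qed.

Lemma continuous_sqn n : continuous (@sqn n).
Proof.
apply: continuous_big => [|i _]; first exact: (@add_continuous R).
move=> x; apply: (@continuous_comp _ _ _ (fun x : 'rV[R]_n => x 0 i) (fun y => y ^+ 2)).
  exact: coord_continuous.
exact: exprn_continuous.
Qed.

(* If z is interior to both x + K and y + K, then z + e(y - x) is in x + K and *)
(* z + e(x - y) in y + K for small e, so (1 + 2e)(y - x) is in K - K.          *)
Lemma lattice_packing_span_int n (K : set 'rV[R]_n) (B : 'M[R]_n) :
  B \in unitmx ->
  (forall (z : 'rV[int]_n) k1 k2 t, K k1 -> K k2 -> 1 < t ->
     k1 - k2 = t *: (map_mx intr z *m B) -> z = 0) ->
  lattice_packing K (span_int B).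
Proof.
move=> uB KB; split; first by exists B.
move=> _ _ [u _ <-] [v _ <-] [z [zu zv]].
set x := _ *m B in zu *; set y := map_mx _ v *m B in zv *.
have near_in (d p : 'rV[R]_n) : [set p + k | k in K]° z ->
    \forall e \near 0^'+, [set p + k | k in K] (z + e *: d).
  move=> zp; have /(_ _ zp) : (z + e *: d) @[e --> 0^'+] --> z.
    rewrite -[X in _ --> X]addr0 -(scale0r d); apply: cvgD; first exact: cvg_cst.
    apply: cvgZr_tmp.
    by apply: cvg_at_right_filter; exact: cvg_id.
  by apply.
have : \forall e \near 0^'+, [/\ 0 < e,
     [set x + k | k in K] (z + e *: (y - x)) &
     [set y + k | k in K] (z + e *: (x - y))].
  near=> e; split; first by near: e; exact: nbhs_right_gt.
  - by near: e; exact: near_in.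
  - by near: e; exact: near_in.
move=> /filter_ex[e [e0 [k1 Kk1 E1] [k2 Kk2 E2]]].
suff : v - u = 0 by move/subr0_eq => vu; rewrite /x /y vu.
apply: (KB _ k1 k2 (1 + e *+ 2)) => //; first by rewrite ltrDl mulrn_wgt0.
rewrite map_mxB mulmxBl -/x -/y.
have -> : k1 = z + e *: (y - x) - x by rewrite -E1 addrC addKr.
have -> : k2 = z + e *: (x - y) - y by rewrite -E2 addrC addKr.
by apply/rowP => i; rewrite !mxE; ring.
Unshelve. all: by end_near. Qed.

(** If a lattice vector [d] had length below 2, then [d / 2] would be interior to the unit balls
    centred at 0 and at [d]; disjointness forces [d = 0]. *)
Lemma ball_packing_sqn n (B : 'M[R]_n) (z : 'rV[int]_n) :
  B \in unitmx -> trivIset (span_int B)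
    (fun x => [set x + k | k in euclidean_ball R n]°) ->
  z != 0 -> 4 <= sqn (map_mx intr z *m B).
Proof.
move=> uB tB z0; rewrite leNgt; apply/negP => z4.
set d := map_mx intr z *m B in z4.
have int_ball (p x : 'rV[R]_n) : sqn (x - p) < 1 ->
    [set p + k | k in euclidean_ball R n]° x.
  move=> xp; have : \forall y \near x, sqn (y - p) < 1.
    have : sqn (y - p) @[y --> x] --> sqn (x - p).
      apply: (@continuous_comp _ _ _ (fun y : 'rV[R]_n => y - p) (@sqn n));
        last exact: continuous_sqn.
      by apply: (cvgB (F := nbhs x)); [exact: cvg_id|exact: cvg_cst].
    by move=> /cvgr_lt/(_ _ xp).
  apply: filterS => y yp; exists (y - p); last by rewrite addrC subrK.
  by rewrite euclidean_ballE /=; exact: ltW.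
have half : sqn (2^-1 *: d) < 1 by rewrite sqnZ; lra.
suff d0 : 0 = d.
  move: z0 => /eqP; apply; apply: map_intr_eq0.
  by rewrite -[LHS](mulmxK uB) -/d -d0 mul0mx.
apply: tB; [by exists 0 => //; rewrite map_mx0 mul0mx|by exists z|].
exists (2^-1 *: d); split; apply: int_ball; first by rewrite subr0.
rewrite (_ : _ - d = (-1) *: (2^-1 *: d));
  first by rewrite sqnZ sqrrN expr1n mul1r.
by apply/rowP => i; rewrite !mxE; field.
Qed.

Lemma ball4_packing_covol (L : set 'rV[R]_4) :
  lattice_packing (euclidean_ball R 4) L -> 8 <= covol L.
Proof.
move=> [[B LB] tL]; rewrite (covolE LB); case: LB => uB LE.
rewrite LE in tL.
have : (4 : R) ^+ 4 <= 4 * \det (B *m B^T).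
  apply: Hermite_constant4 => //; first exact: posdef_gram.
  by move=> w w0; rewrite -sqn_mulmx; exact: ball_packing_sqn.
rewrite det_mulmx det_tr -expr2 -real_normK ?num_real//.
by have := normr_ge0 (\det B); nra.
Qed.

End packings.

(** * The Hurwitz lattice and the icosian lattice *)

Section lattices.
Variable R : realType.

Definition mx4 (s : seq (seq R)) : 'M[R]_4 :=
  \matrix_(i, j) nth 0 (nth [::] s i) j.

Lemma big_ord4 (f : nat -> R) :
  \sum_(i < 4) f i = f 0%N + f 1%N + f 2%N + f 3%N.
Proof. by rewrite !big_ord_recl big_ord0 addr0 !addrA. Qed.

Definition coord n (z : 'rV[int]_n.+1) (k : nat) : int := z 0 (inord k).

Lemma mulmx_mx4 s (x : 'rV[R]_4) (f : nat -> R) (j : 'I_4) :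
  (forall i : 'I_4, x 0 i = f i) ->
  (x *m mx4 s) 0 j = f 0%N * nth 0 (nth [::] s 0) j +
    f 1%N * nth 0 (nth [::] s 1) j + f 2%N * nth 0 (nth [::] s 2) j +
    f 3%N * nth 0 (nth [::] s 3) j.
Proof.
move=> xf; rewrite -(big_ord4 (fun i => f i * nth 0 (nth [::] s i) j)) mxE.
by apply: eq_bigr => i _; rewrite mxE xf.
Qed.

Lemma sqn_mulmx_mx4 s (x : 'rV[R]_4) (f : nat -> R) :
  (forall i : 'I_4, x 0 i = f i) ->
  let y j := f 0%N * nth 0 (nth [::] s 0) j +
    f 1%N * nth 0 (nth [::] s 1) j + f 2%N * nth 0 (nth [::] s 2) j +
    f 3%N * nth 0 (nth [::] s 3) j in
  sqn (x *m mx4 s) = y 0%N ^+ 2 + y 1%N ^+ 2 + y 2%N ^+ 2 + y 3%N ^+ 2.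
Proof.
move=> xf y; rewrite -(big_ord4 (fun j => y j ^+ 2)); apply: eq_bigr => j _.
by rewrite (mulmx_mx4 _ _ xf).
Qed.

Lemma det_trig_mx4 s :
  (forall i j : 'I_4, (i < j)%N -> nth 0 (nth [::] s i) j = 0) ->
  \det (mx4 s) = \prod_(i < 4) nth 0 (nth [::] s i) i.
Proof.
move=> H; rewrite det_trig; first by apply: eq_bigr => i _; rewrite mxE.
by apply/is_trig_mxP => i j ij; rewrite mxE H.
Qed.

Lemma rV4_eq0 (z : 'rV[int]_4) :
  coord z 0 = 0 -> coord z 1 = 0 -> coord z 2 = 0 -> coord z 3 = 0 -> z = 0.
Proof.
move=> h0 h1 h2 h3; apply/rowP => i; rewrite mxE -[i]inord_val.
by case: i => -[|[|[|[|//]]]].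
Qed.

(* Twice the Hurwitz integers, a copy of D4 scaled to minimal norm 2. *)
Definition Hurwitz_basis :=
  mx4 [:: [:: 2; 0; 0; 0]; [:: 0; 2; 0; 0]; [:: 0; 0; 2; 0]; [:: 1; 1; 1; 1]].

Lemma det_Hurwitz : \det Hurwitz_basis = 8.
Proof.
rewrite det_trig_mx4; first by rewrite !big_ord_recl big_ord0 /=; ring.
by move=> [[|[|[|[|//]]]] ?] [[|[|[|[|//]]]] ?].
Qed.

Lemma unit_Hurwitz : Hurwitz_basis \in unitmx.
Proof. by rewrite unitmxE det_Hurwitz unitfE. Qed.

(** The four coordinates are integers of equal parity. If one vanishes, all are even and a nonzero
    one contributes at least 4; otherwise each contributes at least 1. *)
Lemma sqn_Hurwitz_ge4 (z : 'rV[int]_4) :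
  z != 0 -> 4 <= sqn (map_mx intr z *m Hurwitz_basis).
Proof.
move=> z0; pose a := coord z 0; pose b := coord z 1.
pose c := coord z 2; pose d := coord z 3.
have -> : sqn (map_mx intr z *m Hurwitz_basis) =
    ((a * 2 + d) ^+ 2 + (b * 2 + d) ^+ 2 + (c * 2 + d) ^+ 2 + d ^+ 2)%:~R.
  rewrite (@sqn_mulmx_mx4 _ _ (fun k => (coord z k)%:~R)); last first.
    by move=> i; rewrite mxE /coord inord_val.
  by rewrite /= -/a -/b -/c -/d !(rmorphD, rmorphXn, rmorphM) /=; ring.
have : ~~ [&& a == 0, b == 0, c == 0 & d == 0].
  apply: contra z0 => /and4P[/eqP a0 /eqP b0 /eqP c0 /eqP d0].
  by apply/eqP/rV4_eq0.
rewrite -[4]/(4%:~R) ler_int; move: a b c d => a b c d nz.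
have sq1 (x : int) : x != 0 -> 1 <= x ^+ 2.
  by rewrite -sqrf_eq0; have := sqr_ge0 x; move: (x ^+ 2) => y; lia.
have sq4 (x : int) : x != 0 -> 4 <= (x * 2) ^+ 2.
  by move=> /sq1; rewrite exprMn; lia.
have := sqr_ge0 (a * 2 + d); have := sqr_ge0 (b * 2 + d).
have := sqr_ge0 (c * 2 + d); have := sqr_ge0 d.
have [d0|dn0] := eqVneq d 0.
  move: nz; rewrite d0 eqxx !addr0 andbT expr0n !negb_and.
  by case/or3P => /sq4; lia.
have dE x : x * 2 + d = 0 -> 4 <= d ^+ 2.
  move=> xd; have -> : d = - x * 2 by lia.
  by apply: sq4; lia.
have [/dE|/sq1] := eqVneq (a * 2 + d) 0; first lia.
have [/dE|/sq1] := eqVneq (b * 2 + d) 0; first lia.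
have [/dE|/sq1] := eqVneq (c * 2 + d) 0; first lia.
by have := sq1 _ dn0; lia.
Qed.

(* Twice the Gram matrix of the rows is the H4 Cartan matrix, with t for the  *)
(* golden ratio 2 cos(pi/5) or its conjugate and nodes in the order 1, 3, 2, 4, *)
(* chosen to make the matrix triangular. The rows span the icosians over Z[t]. *)
Definition icosian_basis (t : R) :=
  mx4 [:: [:: 1; 0; 0; 0]; [:: 0; 1; 0; 0];
          [:: - t / 2; - 1 / 2; (t - 1) / 2; 0];
          [:: 0; - 1 / 2; - t / 2; (t - 1) / 2]].

Lemma det_icosian t : \det (icosian_basis t) = (t - 1) ^+ 2 / 4.
Proof.
rewrite det_trig_mx4; first by rewrite !big_ord_recl big_ord0 /=; field.
by move=> [[|[|[|[|//]]]] ?] [[|[|[|[|//]]]] ?].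
Qed.

Lemma sqn_icosian (a b : 'rV[int]_4) : exists P Q : int,
  forall t : R, t ^+ 2 = t + 1 ->
    sqn ((map_mx intr a + t *: map_mx intr b) *m icosian_basis t) =
    P%:~R + Q%:~R * t.
Proof.
(* [p] and [q] are the coordinates on the basis 1, t of the product of two elements
   [coord a i + t * coord b i] of Z[t]. *)
have [p pE] : exists p : nat -> nat -> int, forall i j,
    p i j = coord a i * coord a j + coord b i * coord b j by eexists.
have [q qE] : exists q : nat -> nat -> int, forall i j,
    q i j = coord a i * coord b j + coord b i * coord a j +
            coord b i * coord b j by eexists.
exists (p 0%N 0%N + p 1%N 1%N + p 2%N 2%N + p 3%N 3%N -
  q 0%N 2%N - p 1%N 2%N - p 1%N 3%N).
exists (q 0%N 0%N + q 1%N 1%N + q 2%N 2%N + q 3%N 3%N -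
  (p 0%N 2%N + q 0%N 2%N) - q 1%N 2%N - q 1%N 3%N).
move=> t t2; pose n k : R := (coord a k)%:~R + t * (coord b k)%:~R.
have nn i j : n i * n j = (p i j)%:~R + (q i j)%:~R * t.
  rewrite /n pE qE !(intrD, intrM).
  move: (coord a i)%:~R (coord b i)%:~R (coord a j)%:~R (coord b j)%:~R => x y z w.
  transitivity (x * z + (x * w + y * z) * t + y * w * t ^+ 2); first by ring.
  by rewrite t2; ring.
have tnn i j : t * (n i * n j) = (q i j)%:~R + (p i j + q i j)%:~R * t.
  rewrite nn intrD; move: (p i j)%:~R (q i j)%:~R => x y.
  transitivity (x * t + y * t ^+ 2); first by ring.
  by rewrite t2; ring.
rewrite (@sqn_mulmx_mx4 _ _ n); last first.
  by move=> i; rewrite !mxE /n /coord inord_val.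
(* The terms with denominator 2 assemble into a multiple of [t^2 - t - 1], which vanishes. *)
rewrite /=; transitivity (n 0%N * n 0%N + n 1%N * n 1%N + n 2%N * n 2%N + n 3%N * n 3%N -
    t * (n 0%N * n 2%N) - n 1%N * n 2%N - n 1%N * n 3%N +
    (t ^+ 2 - (t + 1)) / 2 * (n 2%N ^+ 2 + n 3%N ^+ 2 - n 2%N * n 3%N)).
  by field.
by rewrite t2 subrr !mul0r addr0 !tnn !nn !(intrD, intrB, rmorphN) /=; ring.
Qed.

Definition tau : R := (1 + Num.sqrt 5) / 2.
Definition tau' : R := (1 - Num.sqrt 5) / 2.

Lemma sqrt5 : Num.sqrt 5 ^+ 2 = 5 :> R.
Proof. by rewrite sqr_sqrtr. Qed.

Lemma sqrt5_bounds : 22 / 10 < (Num.sqrt 5 : R) < 23 / 10.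
Proof.
have := sqrt5; have := sqrtr_ge0 (5 : R); move: (Num.sqrt 5) => s s0 s2.
by apply/andP; split; nra.
Qed.

Lemma tau_sqr : tau ^+ 2 = tau + 1.
Proof.
rewrite /tau; transitivity ((1 + 2 * Num.sqrt 5 + Num.sqrt 5 ^+ 2) / 4 : R).
  by field.
by rewrite sqrt5; field.
Qed.

Lemma tau'_sqr : tau' ^+ 2 = tau' + 1.
Proof.
rewrite /tau'; transitivity ((1 - 2 * Num.sqrt 5 + Num.sqrt 5 ^+ 2) / 4 : R).
  by field.
by rewrite sqrt5; field.
Qed.

(** Subtracting the two ranges confines [Q * sqrt 5] to an interval leaving only [Q = 0] and
    [Q = -1]. The latter forces [P = 2], and [2 - tau' = tau^2] exactly, so the strict upper bound
    excludes it. *)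
Lemma golden_small (P Q : int) :
  0 <= P%:~R + Q%:~R * tau < 1 -> 0 <= P%:~R + Q%:~R * tau' < tau ^+ 2 ->
  P = 0 /\ Q = 0.
Proof.
rewrite tau_sqr /tau /tau'; have /andP[] := sqrt5_bounds.
move: (Num.sqrt 5) => s s1 s2 /andP[h1 h2] /andP[h3 h4].
have Q1 : Q < 1 by rewrite -(ltr_int R) rmorph1; nra.
have Q2 : -2 < Q by rewrite -(ltr_int R) rmorphN/=; nra.
have [Q0|Q0] : Q = 0 \/ Q = -1 by lia.
  subst Q; split => //.
  have P1 : P < 1 by rewrite -(ltr_int R) rmorph1; lra.
  have P2 : -1 < P by rewrite -(ltr_int R) rmorphN1; lra.
  lia.
subst Q; exfalso.
have P1 : P < 3 by rewrite -(ltr_int R); lra.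
have P2 : 1 < P by rewrite -(ltr_int R) rmorph1; lra.
have P0 : P = 2 by lia.
by subst P; lra.
Qed.

(** Here [tau - 1] is [tau^-1]. The block rows are the images of the Z[tau]-basis and of [tau] times
    it; in the second embedding [tau] acts as [tau']. *)
Definition icosian_pair_basis : 'M[R]_(4 + 4) :=
  block_mx (2 *: icosian_basis tau) ((2 * (tau - 1)) *: icosian_basis tau')
    ((2 * tau) *: icosian_basis tau)
    ((2 * (tau - 1) * tau') *: icosian_basis tau').

Lemma mulmx_icosian_pair (a b : 'rV[R]_4) :
  row_mx a b *m icosian_pair_basis =
  row_mx (2 *: ((a + tau *: b) *m icosian_basis tau))
    ((2 * (tau - 1)) *: ((a + tau' *: b) *m icosian_basis tau')).
Proof.
rewrite mul_row_block -!scalemxAr !mulmxDl -!scalemxAl !scalerDr !scalerA.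
by [].
Qed.

Lemma det_icosian_pair : \det icosian_pair_basis = 400 * (tau - 1) ^+ 4.
Proof.
(* The block matrix with rows (1, 1) and (tau, tau') is factored out. Its determinant is
   [(tau' - tau)^4 = 25]. *)
have -> : icosian_pair_basis =
    block_mx 1%:M 0 tau%:M 1%:M *m block_mx 1%:M 1%:M 0 (tau' - tau)%:M *m
    block_mx (2 *: icosian_basis tau) 0
      0 ((2 * (tau - 1)) *: icosian_basis tau').
  rewrite !mulmx_block !(mul1mx, mulmx1, mul0mx, mulmx0, addr0, add0r).
  rewrite -raddfD addrCA subrr addr0 !mul_scalar_mx !scalerA.
  by rewrite [tau * _]mulrC [tau' * _]mulrC.
rewrite !det_mulmx !det_lblock det_ublock !det1 !detZ !det_scalar !det_icosian.
have -> : tau' - tau = - Num.sqrt 5 by rewrite /tau /tau'; field.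
have -> : (- Num.sqrt 5) ^+ 4 = 25 :> R.
  by rewrite (exprM _ 2 2) sqrrN sqrt5; ring.
have : (tau' - 1) ^+ 2 * (tau - 1) ^+ 2 = 1.
  rewrite -exprMn (_ : _ * _ = -1) ?sqrrN ?expr1n// /tau /tau'.
  transitivity ((1 - Num.sqrt 5 ^+ 2) / 4 : R); first by field.
  by rewrite sqrt5; field.
move: (tau - 1) (tau' - 1) => u v uv.
transitivity (400 * u ^+ 4 * (v ^+ 2 * u ^+ 2)); first by field.
by rewrite uv mulr1.
Qed.

Lemma icosian_pair_unit : icosian_pair_basis \in unitmx.
Proof.
rewrite unitmxE det_icosian_pair unitfE mulf_neq0 ?pnatr_eq0//.
rewrite expf_neq0// gt_eqF// /tau; have /andP[] := sqrt5_bounds; lra.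
Qed.

Lemma icosian_pair_packing :
  lattice_packing (cart_prod (euclidean_ball R 4) (euclidean_ball R 4))
    (span_int icosian_pair_basis).
Proof.
apply: lattice_packing_span_int => [|z k1 k2 t]; first exact: icosian_pair_unit.
move=> [x1 Bx1 [y1 By1 <-]] [x2 Bx2 [y2 By2 <-]] t1.
rewrite opp_row_mx add_row_mx -(hsubmxK z) map_row_mx mulmx_icosian_pair.
set a := lsubmx z; set b := rsubmx z.
set u := _ *m icosian_basis tau; set v := _ *m icosian_basis tau'.
rewrite scale_row_mx => /eq_row_mx[/(ball_sub_sqn Bx1 Bx2 t1) u4
  /(ball_sub_sqn By1 By2 t1) v4].
have [P [Q PQ]] := sqn_icosian a b.
have uE := PQ _ tau_sqr; have vE := PQ _ tau'_sqr.
rewrite -/u in uE; rewrite -/v in vE.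
have u1 : 0 <= sqn u < 1.
  by rewrite sqn_ge0; move: u4; rewrite sqnZ; lra.
have v1 : 0 <= sqn v < tau ^+ 2.
  rewrite sqn_ge0 /=; move: v4; rewrite sqnZ.
  have -> : (2 * (tau - 1)) ^+ 2 * sqn v = 4 * ((tau - 1) ^+ 2 * sqn v) by ring.
  rewrite gtr_pMr// => v4.
  have t0 : 0 < tau ^+ 2.
    by rewrite tau_sqr /tau; have /andP[] := sqrt5_bounds; lra.
  (* Multiplying by [tau^2] removes the scaling [(tau - 1)^2], since [tau (tau - 1) = 1]. *)
  rewrite -(ltr_pM2l t0) mulr1 mulrA -exprMn in v4.
  have E : tau * (tau - 1) = 1 by rewrite mulrBr -expr2 tau_sqr mulr1 addrC addKr.
  by rewrite E expr1n mul1r in v4.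
rewrite uE in u1; rewrite vE in v1.
have [P0 Q0] := golden_small u1 v1.
have u0 : u = 0 by apply/eqP; rewrite -sqn_eq0 uE P0 Q0 mul0r addr0.
have v0 : v = 0 by apply/eqP; rewrite -sqn_eq0 vE P0 Q0 mul0r addr0.
apply: (@map_intr_eq0 R); rewrite map_row_mx -[LHS](mulmxK icosian_pair_unit).
by rewrite mulmx_icosian_pair -/u -/v u0 v0 !scaler0 row_mx0 mul0mx.
Qed.

Lemma Hurwitz_packing :
  lattice_packing (euclidean_ball R 4) (span_int Hurwitz_basis).
Proof.
apply: lattice_packing_span_int => [|z k1 k2 t B1 B2 t1 E].
  exact: unit_Hurwitz.
apply/eqP; apply: contraT => /sqn_Hurwitz_ge4.
by rewrite leNgt (ball_sub_sqn B1 B2 t1 E).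
Qed.

End lattices.

(** * Volumes of balls and of products *)

Section ball_volume.
Variable R : realType.
Let mu := @lebesgue_measure R.

(** The substitution [x = sqrt rho * sin t] turns the integral of ball slices into that of a power
    of cosine, with antiderivative [F]. As [Num.sqrt] is 0 on negatives and [k > 0], values of [x]
    outside the ball contribute nothing. *)
Lemma integral_sqrt_pow (F : R -> R) (c : R) (k : nat) (rho : R) : (0 < k)%N ->
  (forall x : R, is_derive x (1 : R) F (c * cos x ^+ k.+1)) ->
  (\int[mu]_x ((c * Num.sqrt (rho - x ^+ 2) ^+ k)%:E) =
   (Num.sqrt rho ^+ k.+1 * (F (pi / 2) - F (- (pi / 2))))%:E)%E.
Proof.
move=> k0 dF.
have sqrt_neg (y : R) : y <= 0 -> c * Num.sqrt y ^+ k = 0.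
  by move=> y0; rewrite ler0_sqrtr// expr0n gtn_eqF// mulr0.
have [rho0|rho0] := lerP rho 0.
  rewrite ler0_sqrtr// expr0n/= mul0r integral0_eq// => x _.
  by rewrite sqrt_neg// subr_le0 (le_trans rho0)// sqr_ge0.
set r : R := Num.sqrt rho.
have r0 : 0 < r by rewrite sqrtr_gt0.
have r2 : rho = r ^+ 2 by rewrite sqr_sqrtr// ltW.
have pi0 : - (pi / 2) < pi / 2 :> R by have := pi_gt0 R; lra.
have -> : (\int[mu]_x ((c * Num.sqrt (rho - x ^+ 2) ^+ k)%:E) =
    \int[mu]_(x in `[(- r)%R, r]) ((c * Num.sqrt (rho - x ^+ 2) ^+ k)%:E))%E.
  rewrite [RHS]integral_mkcond; apply: eq_integral => x _; rewrite patchE.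
  case: ifPn => //; rewrite notin_setE/= in_itv/= => /negP.
  rewrite -ler_norml -ltNge => rx; rewrite sqrt_neg// subr_le0 r2.
  by rewrite -[leRHS]real_normK ?num_real// lerXn2r ?nnegrE// ltW.
pose S (t : R) := r * sin t.
have dS x : is_derive x (1 : R) S (r * cos x).
  by rewrite /S; apply: is_derive_eq.
have dSE : S^`()%classic = fun x => r * cos x.
  by apply/funext => x; rewrite derive1E derive_val.
have cS : continuous S.
  by move=> x; apply/differentiable_continuous/derivable1_diffP.
have cdS : continuous (fun x : R => r * cos x).
  move=> x; apply: cvgM; first exact: cvg_cst.
  exact: continuous_cos.
have cG : continuous (fun x : R => c * Num.sqrt (rho - x ^+ 2) ^+ k : R).
  move=> x; apply: cvgM; first exact: cvg_cst.
  apply: (@continuous_comp _ _ _ (fun x : R => Num.sqrt (rho - x ^+ 2) : R)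
    (fun y : R => y ^+ k)); last exact: exprn_continuous.
  apply: (@continuous_comp _ _ _ (fun x : R => rho - x ^+ 2 : R) (@Num.sqrt R));
    last exact: sqrt_continuous.
  by apply: cvgB; [exact: cvg_cst|exact: exprn_continuous].
have -> : - r = S (- (pi / 2)) by rewrite /S sinN sin_pihalf mulrN1.
have -> : r = S (pi / 2) by rewrite /S sin_pihalf mulr1.
rewrite integration_by_substitution_increasing//; first last.
- exact: continuous_subspaceT.
- split.
  + by move=> x _; exact: ex_derive.
  + by apply: cvg_at_right_filter; exact: cS.
  + by apply: cvg_at_left_filter; exact: cS.
- rewrite dSE; apply/cvg_ex; eexists; apply: cvg_at_left_filter; exact: cdS.
- rewrite dSE; apply/cvg_ex; eexists; apply: cvg_at_right_filter; exact: cdS.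
- by move=> x _; rewrite dSE; exact: cdS.
- by move=> x y hx hy xy; rewrite /S ltr_pM2l// ltr_sin.
- exact: ltW.
rewrite (eq_integral (fun x : measurableTypeR R =>
  (r ^+ k.+1 * (c * cos x ^+ k.+1))%:E)); last first.
  move=> x; rewrite inE/= in_itv/= => xpi; rewrite dSE /S; congr EFin.
  change (c * Num.sqrt (rho - (r * sin x) ^+ 2) ^+ k * (r * cos x) =
    r ^+ k.+1 * (c * cos x ^+ k.+1)).
  have -> : rho - (r * sin x) ^+ 2 = (r * cos x) ^+ 2.
    by rewrite !exprMn -r2 cos2sin2; ring.
  rewrite sqrtr_sqr ger0_norm; last first.
    by rewrite mulr_ge0 ?cos_ge0_pihalf// ltW.
  by rewrite -mulrA -exprSr exprMn mulrCA.
rewrite (@continuous_FTC2 _ _ (fun x => r ^+ k.+1 * F x)) //.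
- by rewrite -EFinB mulrBr /S sin_pihalf mulr1.
- apply: continuous_subspaceT => x; apply: cvgM; first exact: cvg_cst.
  apply: cvgM; first exact: cvg_cst.
  apply: (@continuous_comp _ _ _ cos (fun y => y ^+ k.+1)); first exact: continuous_cos.
  exact: exprn_continuous.
- have cF x : {for x, continuous (fun x => r ^+ k.+1 * F x)}.
    by apply/differentiable_continuous/derivable1_diffP.
  split.
  + by move=> x _; exact: ex_derive.
  + by apply: cvg_at_right_filter; exact: cF.
  + by apply: cvg_at_left_filter; exact: cF.
- by move=> x _; rewrite derive1E derive_val.
Qed.

(** Indexed by the squared radius, possibly negative, so that the slice at [x] is again such a ball,
    with parameter [rho - x^2]. *)
Definition tball n (rho : R) : set (n.-tuple (measurableTypeR R)) :=
  [set t | \sum_i tnth t i ^+ 2 <= rho].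
Arguments tball : clear implicits.

Lemma lebesgue_tupleS n (A : set (n.+1.-tuple (measurableTypeR R))) :
  lebesgue_tuple R n.+1 A =
  (\int[mu]_x lebesgue_tuple R n
    [set t : n.-tuple (measurableTypeR R) | A [tuple of x :: t]])%E.
Proof.
rewrite /= /lebesgue_cons /pushforward /product_measure1.
apply: eq_integral => x _ /=; congr (lebesgue_tuple R n _).
by apply/seteqP; split=> t; rewrite /xsection/= inE.
Qed.

Lemma lebesgue_tballS n rho :
  lebesgue_tuple R n.+1 (tball n.+1 rho) =
  (\int[mu]_x lebesgue_tuple R n (tball n (rho - x ^+ 2)))%E.
Proof.
rewrite lebesgue_tupleS; apply: eq_integral => x _.
have E (t : n.-tuple (measurableTypeR R)) :
    \sum_i tnth [tuple of x :: t] i ^+ 2 = x ^+ 2 + \sum_i tnth t i ^+ 2.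
  rewrite big_ord_recl tnth0; congr (_ + _).
  by apply: eq_bigr => i _; rewrite tnthS.
congr (lebesgue_tuple R n _); apply/seteqP.
by split=> t; rewrite /tball/= E lerBrDl.
Qed.

Lemma lebesgue_tball1 rho :
  lebesgue_tuple R 1 (tball 1 rho) = (2 * Num.sqrt rho)%:E.
Proof.
have [rho0|rho0] := ltrP rho 0.
  rewrite ler0_sqrtr 1?ltW// mulr0 (_ : tball 1 rho = set0) ?measure0//.
  apply/seteqP; split=> // t; rewrite /tball/= big_ord1 => h.
  by have := lt_le_trans rho0 (sqr_ge0 (tnth t ord0)); rewrite ltNge h.
have -> : tball 1 rho =
    [set t | forall i, `[(- Num.sqrt rho)%R, Num.sqrt rho]%classic (tnth t i)].
  have E (t : 1.-tuple (measurableTypeR R)) i :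
      tball 1 rho t <-> `[(- Num.sqrt rho)%R, Num.sqrt rho]%classic (tnth t i).
    rewrite /tball/= big_ord1 (ord1 i) in_itv/= -ler_norml.
    by rewrite -sqrtr_sqr ler_sqrt.
  by apply/seteqP; split=> t; [move=> + i; rewrite (E t i)|move=> /(_ ord0); rewrite -E].
rewrite (@lebesgue_tuple_box R 1
  (fun=> `[(- Num.sqrt rho)%R, Num.sqrt rho]%classic))//.
rewrite big_ord1 lebesgue_measure_itv/= lte_fin.
case: ltP => h; first by rewrite -EFinB; congr EFin; ring.
by congr EFin; have := sqrtr_ge0 rho; lra.
Qed.

Lemma lebesgue_tball2 rho :
  lebesgue_tuple R 2 (tball 2 rho) = (pi * Num.sqrt rho ^+ 2)%:E.
Proof.
rewrite lebesgue_tballS.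
under eq_integral do rewrite lebesgue_tball1 -[Num.sqrt _]expr1.
pose F (x : R) := x + sin x * cos x.
have dF x : is_derive x (1 : R) F (2 * cos x ^+ 2).
  apply: is_derive_eq; have := cos2Dsin2 x; rewrite /GRing.scale/=; lra.
rewrite (integral_sqrt_pow _ _ dF)// /F sinN cosN sin_pihalf cos_pihalf.
by congr EFin; field.
Qed.

Lemma lebesgue_tball3 rho :
  lebesgue_tuple R 3 (tball 3 rho) = (4 / 3 * pi * Num.sqrt rho ^+ 3)%:E.
Proof.
rewrite lebesgue_tballS.
under eq_integral do rewrite lebesgue_tball2.
pose F (x : R) := pi * (sin x - 3^-1 * sin x ^+ 3).
have dF x : is_derive x (1 : R) F (pi * cos x ^+ 3).
  by apply: is_derive_eq; rewrite /GRing.scale/= exprS cos2sin2; field.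
rewrite (integral_sqrt_pow _ _ dF)// /F sinN sin_pihalf.
by congr EFin; field.
Qed.

Lemma lebesgue_tball4 : lebesgue_tuple R 4 (tball 4 1) = (pi ^+ 2 / 2)%:E.
Proof.
rewrite lebesgue_tballS.
under eq_integral do rewrite lebesgue_tball3.
(* The antiderivative of [cos^4] from the usual reduction formula, scaled by the volume constant of
   the 3-ball. *)
pose F (x : R) :=
  4 / 3 * pi * (4^-1 * (cos x ^+ 3 * sin x) + 3 / 8 * (x + sin x * cos x)).
have dF x : is_derive x (1 : R) F (4 / 3 * pi * cos x ^+ 4).
  apply: is_derive_eq; rewrite /GRing.scale/=.
  have := sin2cos2 x; move: (cos x) (sin x) => c s s2.
  transitivity (4 / 3 * pi * (4^-1 * (c ^+ 4 - 3 * c ^+ 2 * s ^+ 2) +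
    3 / 8 * (1 - s ^+ 2 + c ^+ 2))); first by field.
  by rewrite s2; field.
rewrite (integral_sqrt_pow _ _ dF)// /F sinN cosN sin_pihalf cos_pihalf sqrtr1.
by congr EFin; field.
Qed.

Lemma measurable_tball n rho : measurable (tball n rho).
Proof.
have -> : tball n rho = (fun t => \sum_i tnth t i ^+ 2) @^-1` `]-oo, rho]%classic.
  by apply/seteqP; split=> t; rewrite /tball/= in_itv.
rewrite -[X in measurable X]setTI.
suff : measurable_fun setT (fun t : n.-tuple (measurableTypeR R) =>
    \sum_i tnth t i ^+ 2 : measurableTypeR R) by apply.
apply: measurable_sum => i; apply: measurable_realfun.measurable_funX.
exact: measurable_tnth.
Qed.

Lemma euclidean_ball_tuple n :
  [set t : n.-tuple (measurableTypeR R) |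
    euclidean_ball R n (\row_i tnth t i)] = tball n 1.
Proof.
have E (t : n.-tuple (measurableTypeR R)) :
    sqn (\row_i tnth t i) = \sum_i tnth t i ^+ 2.
  by apply: eq_bigr => i _; rewrite mxE.
by rewrite euclidean_ballE; apply/seteqP; split=> t; rewrite /tball/= E.
Qed.

Lemma vol_ball4 : vol (euclidean_ball R 4) = (pi ^+ 2 / 2)%:E.
Proof. by rewrite /vol euclidean_ball_tuple lebesgue_tball4. Qed.

(** Induction on [m], slicing along the first coordinate: each slice is a product with the same [B],
    whose measure factors out of the integral. The base case is the Dirac mass at the empty
    tuple. *)
Lemma lebesgue_tuple_cat m n (A : set (m.-tuple (measurableTypeR R)))
    (B : set (n.-tuple (measurableTypeR R))) :
  measurable A -> measurable B ->
  lebesgue_tuple R (m + n) [set t : (m + n).-tuple (measurableTypeR R) |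
    A [tuple tnth t (lshift n i) | i < m] /\
    B [tuple tnth t (rshift m i) | i < n]] =
  (lebesgue_tuple R m A * lebesgue_tuple R n B)%E.
Proof.
move=> + mB; elim: m A => [|m IH] A mA.
  rewrite [X in (X * _)%E]diracE.
  have E (t : (0 + n).-tuple (measurableTypeR R)) :
      [tuple tnth t (rshift 0 i) | i < n] = t.
    by apply: eq_from_tnth => i; rewrite tnth_mktuple; congr tnth; exact/val_inj.
  have [A0|A0] := boolP ([tuple] \in A).
    rewrite mul1e; congr (lebesgue_tuple R n _); apply/seteqP.
    split=> t /=; rewrite E; first by case.
    by move=> Bt; split=> //; rewrite [X in A X]tuple0; rewrite inE in A0.
  rewrite mul0e -[RHS](measure0 (lebesgue_tuple R n)).
  congr (lebesgue_tuple R n _); apply/seteqP; split=> t //= [At _].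
  by move: A0; rewrite notin_setE [X in A X]tuple0 in At *.
pose S x := [set t : m.-tuple (measurableTypeR R) | A [tuple of x :: t]].
have mA2 : measurable ((fun p : measurableTypeR R * m.-tuple (measurableTypeR R) =>
    [tuple of p.1 :: p.2]) @^-1` A).
  rewrite -[X in measurable X]setTI.
  suff : measurable_fun setT (fun p : measurableTypeR R * m.-tuple (measurableTypeR R) =>
    [tuple of p.1 :: p.2]) by apply.
  by apply: (@measurable_cons _ _ _ _ fst _ snd);
    [exact: measurable_fst|exact: measurable_snd].
have SE x : xsection ((fun p : measurableTypeR R * m.-tuple (measurableTypeR R) =>
    [tuple of p.1 :: p.2]) @^-1` A) x = S x.
  by apply/seteqP; split=> t; rewrite /xsection/= inE.
have mS x : measurable (S x) by rewrite -SE; exact: measurable_xsection.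
rewrite !lebesgue_tupleS -ge0_integralZr//; last first.
  have := measurable_fun_xsection (lebesgue_tuple R m) mA2.
  by apply: eq_measurable_fun => x _ /=; rewrite SE.
apply: eq_integral => x _; rewrite -(IH (S x))//.
congr (lebesgue_tuple R (m + n) _).
have E1 (t : (m + n).-tuple (measurableTypeR R)) :
    [tuple tnth [tuple of x :: t] (lshift n i) | i < m.+1] =
    [tuple of x :: [tuple tnth t (lshift n i) | i < m]].
  apply: eq_from_tnth => i; rewrite tnth_mktuple; case: (unliftP ord0 i) => [j ->|->].
    by rewrite tnthS tnth_mktuple -(@tnthS _ _ x t); congr tnth; exact/val_inj.
  by rewrite tnth0 -[RHS](@tnth0 _ _ x t); congr tnth; exact/val_inj.
have E2 (t : (m + n).-tuple (measurableTypeR R)) :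
    [tuple tnth [tuple of x :: t] (rshift m.+1 i) | i < n] =
    [tuple tnth t (rshift m i) | i < n].
  apply: eq_from_tnth => i; rewrite !tnth_mktuple -(@tnthS _ _ x t); congr tnth.
  exact/val_inj.
by apply/seteqP; split=> t /=; rewrite E1 E2.
Qed.

Lemma vol_cart_prod m n (K1 : set 'rV[R]_m) (K2 : set 'rV[R]_n) :
  measurable [set t : m.-tuple (measurableTypeR R) | K1 (\row_i tnth t i)] ->
  measurable [set t : n.-tuple (measurableTypeR R) | K2 (\row_i tnth t i)] ->
  vol (cart_prod K1 K2) = (vol K1 * vol K2)%E.
Proof.
move=> mK1 mK2; rewrite /vol -lebesgue_tuple_cat//.
congr (lebesgue_tuple R (m + n) _).
have lE (t : (m + n).-tuple (measurableTypeR R)) :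
    \row_i tnth [tuple tnth t (lshift n i) | i < m] i = lsubmx (\row_i tnth t i).
  by apply/rowP => i; rewrite !mxE tnth_mktuple.
have rE (t : (m + n).-tuple (measurableTypeR R)) :
    \row_i tnth [tuple tnth t (rshift m i) | i < n] i = rsubmx (\row_i tnth t i).
  by apply/rowP => i; rewrite !mxE tnth_mktuple.
apply/seteqP; split=> t /=; rewrite lE rE.
  by move=> [x K1x [y K2y <-]]; rewrite row_mxKl row_mxKr.
move=> [K1t K2t]; exists (lsubmx (\row_i tnth t i)) => //.
by exists (rsubmx (\row_i tnth t i)); rewrite ?hsubmxK.
Qed.

Lemma vol_ball44 :
  vol (cart_prod (euclidean_ball R 4) (euclidean_ball R 4)) = (pi ^+ 4 / 4)%:E.
Proof.
rewrite vol_cart_prod ?euclidean_ball_tuple; try exact: measurable_tball.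
by rewrite vol_ball4 -EFinM; congr EFin; field.
Qed.

End ball_volume.

(** * The densities and their comparison *)

Lemma max_lattice_density_ball4 (R : realType) :
  max_lattice_density (euclidean_ball R 4) = (pi ^+ 2 / 16)%:E.
Proof.
apply/eqP; rewrite eq_le; apply/andP; split.
  apply: ge_ereal_sup => _ [L pL <-]; rewrite /packing_density vol_ball4 -EFinM.
  rewrite lee_fin; have L8 := ball4_packing_covol pL.
  have -> : pi ^+ 2 / 16 = pi ^+ 2 / 2 * 8^-1 :> R by field.
  rewrite ler_wpM2l ?divr_ge0 ?sqr_ge0// lef_pV2 ?posrE//.
  exact: lt_le_trans L8.
apply: ereal_sup_ubound; exists (span_int (Hurwitz_basis R)).
  exact: Hurwitz_packing.
rewrite /packing_density vol_ball4 (@covolE _ _ _ (Hurwitz_basis R)).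
  by rewrite det_Hurwitz ger0_norm// -EFinM; congr EFin; field.
by split=> //; exact: unit_Hurwitz.
Qed.

Lemma max_lattice_density_ball44 (R : realType) :
  ((pi ^+ 4 / 1024 * (1 + 1 / Num.sqrt 5) ^+ 4)%R%:E <=
   max_lattice_density (cart_prod (euclidean_ball R 4) (euclidean_ball R 4)))%E.
Proof.
apply: ereal_sup_ubound; exists (span_int (icosian_pair_basis R)).
  exact: icosian_pair_packing.
rewrite /packing_density vol_ball44 (@covolE _ _ _ (icosian_pair_basis R)).
  rewrite det_icosian_pair ger0_norm; last first.
    by apply: mulr_ge0; rewrite ?ler0n ?exprn_even_ge0.
  rewrite -EFinM; congr EFin.
  have /andP[s0 _] := sqrt5_bounds R; have := sqrt5 R.
  rewrite /tau; move: (Num.sqrt 5) s0 => s s0 s2.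
  (* This is [2 tau / sqrt 5] times [tau^-1]. Its fourth power 16/25 matches the covolume
     [400 tau^-4] with the stated constant. *)
  have h : (1 + 1 / s) * ((1 + s) / 2 - 1) = 2 / s.
    transitivity ((s ^+ 2 - 1) / (2 * s)); first by field; lra.
    by rewrite s2; field; lra.
  have h4 : (1 + 1 / s) ^+ 4 * ((1 + s) / 2 - 1) ^+ 4 = 16 / 25.
    rewrite -exprMn h; transitivity (16 / (s ^+ 2 * s ^+ 2)); first by field; lra.
    by rewrite s2; field.
  move: ((1 + s) / 2 - 1) (1 + 1 / s) h4 => u v uv.
  have u0 : u != 0.
    by apply/eqP => u0; move: uv; rewrite u0 expr0n mulr0; lra.
  transitivity (pi ^+ 4 / 1024 * (16 / 25) / u ^+ 4); first by field.
  by rewrite -uv; field.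
by split=> //; exact: icosian_pair_unit.
Qed.

Theorem theorem10 (R : realType) :
  let B := euclidean_ball R 4 in
  (max_lattice_density (cart_prod B B) >
     max_lattice_density B * max_lattice_density B)%E /\
  [/\ (max_lattice_density (cart_prod B B) >=
         (pi ^+ 4 / 1024 * (1 + 1 / Num.sqrt 5) ^+ 4)%R%:E)%E,
      pi ^+ 4 / 1024 * (1 + 1 / Num.sqrt 5) ^+ 4 > pi ^+ 4 / 256 :> R &
      (pi ^+ 4 / 256)%R%:E = (max_lattice_density B ^+ 2)%E].
Proof.
move=> B; have le44 := max_lattice_density_ball44 R.
have lt44 : pi ^+ 4 / 1024 * (1 + 1 / Num.sqrt 5) ^+ 4 > pi ^+ 4 / 256 :> R.
  have -> : pi ^+ 4 / 256 = pi ^+ 4 / 1024 * 4 :> R by field.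
  have pi4 : 0 < pi ^+ 4 / 1024 :> R.
    by apply: divr_gt0; [apply: exprn_gt0; exact: pi_gt0|rewrite ltr0n].
  rewrite (ltr_pM2l pi4).
  have /andP[s0 s1] := sqrt5_bounds R.
  (* From [sqrt 5 < 23 / 10], the reciprocal exceeds 10/23 > 43/100; and [1.43^4 > 4]. *)
  have h : (143 / 100 : R) < 1 + 1 / Num.sqrt 5.
    rewrite -ltrBlDl ltr_pdivlMr; lra.
  apply: (@lt_trans _ _ ((143 / 100) ^+ 4)); first by lra.
  by rewrite ltrXn2r ?nnegrE//; lra.
have E : (max_lattice_density B * max_lattice_density B)%E =
    (pi ^+ 4 / 256)%R%:E.
  by rewrite max_lattice_density_ball4 -EFinM; congr EFin; field.
split; first by rewrite E; apply: lt_le_trans le44; rewrite lte_fin.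
by split=> //; rewrite -E; rewrite expeS expe1.
Qed.
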